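(* With $\sigma_k$ the $k$-th elementary symmetric polynomial of $a_0,a_1,a_2,a_3$, let $$\mathfrak{f}_t^{ab}(a_0,a_1,a_2,a_3)=\tfrac13\Big(3\sigma_1^4-2(t+7)\sigma_1^2\sigma_2+8(t+1)\sigma_2^2+(t^2-6t+21)\sigma_1\sigma_3-16(t^2+3)\sigma_4\Big),$$ $$\mathfrak{f}_t^{c}(a_0,a_1,a_2,a_3)=\tfrac19\Big(9\sigma_1^4-6(t+7)\sigma_1^2\sigma_2+(t+7)^2\sigma_2^2+12(t-1)\sigma_1\sigma_3-12(t-1)(3t+13)\sigma_4\Big).$$ If $0<t\le5$ and $t\ne1$, then $\mathfrak{f}_t^{ab}(a^2,b^2,c^2,d^2)\notin\Sigma_{4,8}$. If $t>5$, then $\mathfrak{f}_t^c(a^2,b^2,c^2,d^2)\notin\Sigma_{4,8}$.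
   Context: $\Sigma_{4,8}$ is the set of octic forms in $\mathbb{R}[a,b,c,d]$ that are finite sums of squares of real quartic forms. *)

(* Defs.v *)
From mathcomp Require Import all_boot all_order all_algebra.
From mathcomp Require Import reals.
From mathcomp Require Export mpoly.

Set Implicit Arguments.
Unset Strict Implicit.
Unset Printing Implicit Defensive.

Import GRing.Theory.
Local Open Scope ring_scope.

Section Forms.
Variable R : realType.

(* The zero polynomial counts as a form of every degree. *)
Definition Sigma48 (p : {mpoly R[4]}) : Prop :=
  p \is 8.-homog /\
  exists2 s : seq {mpoly R[4]},
    all (fun q => q \is 4.-homog) s & p = \sum_(q <- s) q ^+ 2.

Local Notation s k := (mesym 4 R k).

Definition f_ab (t : R) : {mpoly R[4]} :=
  3^-1 *: (3 *: s 1 ^+ 4 - (2 * (t + 7)) *: (s 1 ^+ 2 * s 2)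
              + (8 * (t + 1)) *: s 2 ^+ 2
              + (t ^+ 2 - 6 * t + 21) *: (s 1 * s 3)
              - (16 * (t ^+ 2 + 3)) *: s 4).

Definition f_c (t : R) : {mpoly R[4]} :=
  9^-1 *: (9 *: s 1 ^+ 4 - (6 * (t + 7)) *: (s 1 ^+ 2 * s 2)
              + ((t + 7) ^+ 2) *: s 2 ^+ 2
              + (12 * (t - 1)) *: (s 1 * s 3)
              - (12 * (t - 1) * (3 * t + 13)) *: s 4).

(* p(a^2, b^2, c^2, d^2) *)
Definition at_squares (p : {mpoly R[4]}) : {mpoly R[4]} :=
  p \mPo [tuple 'X_i ^+ 2 | i < 4].

End Forms.

(* Main.v *)
Require Import Defs.
From mathcomp Require Import all_boot all_order all_algebra reals mpoly.
From mathcomp Require Import ring lra.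

Set Implicit Arguments.
Unset Strict Implicit.
Unset Printing Implicit Defensive.

(** Real zeros are what obstructs a sum of squares.  Let [f] be one of the two
    quartics, and suppose that [f(a^2, b^2, c^2, d^2)] is the sum of the squares
    of quartic forms [q].  If [y >= 0] is a zero of [f], then the sum vanishes
    at all the points [(+-sqrt y_0, ..., +-sqrt y_3)], hence so does each [q].
    Adding the values of [q] over the 16 sign choices keeps only the monomials
    all of whose exponents are even, so the total is a quadratic form [Q] in
    [y] ([sign_sum_quartic]).  Thus each [q] yields a quadratic form [Q] that
    vanishes at every zero of [f] in the nonnegative orthant.

    In both cases [f] has enough such zeros to force the coefficient of
    [y_0^2] in [Q] to be zero.  Up to a factor 16 this coefficient is
    [q(1, 0, 0, 0)] ([sign_sum_axis]), so all the [q] vanish at [(1, 0, 0, 0)].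
    This contradicts [f(1, 0, 0, 0) = 1].  [not_Sigma48] packages this
    criterion; what remains for each family is a list of zeros and one linear
    identity that writes a nonzero multiple of that coefficient in terms of the
    values of [Q] at these zeros:
    - for [f_ab], the zeros are [(1,1,1,1)], [(t,1,1,1)] and the permutations of
      [(1,1,0,0)], and the multiplier is [(t-1)^2];
    - for [f_c], they are [(1,1,1,1)] and the permutations of [(x,1,0,0)], where
      [3 (1 + x^2) = (t + 1) x].  This quadratic has two distinct positive roots,
      inverse to each other, exactly when [t > 5]. *)

Import Order.TTheory GRing.Theory Num.Theory.
Local Open Scope ring_scope.

(** * Averaging a quartic form over sign changes *)

Section SignSum.
Variables (R : comNzRingType) (n : nat).
Implicit Types (q : {mpoly R[n]}) (u y : 'I_n -> R) (C : 'M[R]_n).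

Definition flip (e : {ffun 'I_n -> bool}) u : 'I_n -> R :=
  fun i => (-1) ^+ e i * u i.

Definition sign_sum q u : R :=
  \sum_(e : {ffun 'I_n -> bool}) q.@[flip e u].

Definition quad C y : R := \sum_i \sum_j C i j * y i * y j.

(** The sum over all sign patterns factors over the coordinates, and
    [(-x)^k + x^k] is zero for odd [k]. *)
Lemma sign_sum_monomial (m : 'X_{1..n}) u :
  \sum_(e : {ffun 'I_n -> bool}) \prod_i flip e u i ^+ m i
  = \prod_i (if odd (m i) then 0 else 2 * u i ^+ m i).
Proof.
rewrite -(bigA_distr_bigA (fun i (b : bool) => ((-1) ^+ b * u i) ^+ m i)) /=.
apply: eq_bigr => i _.
rewrite big_bool /= expr1 expr0 !exprMn expr1n -signr_odd.
by case: odd => /=; ring.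
Qed.

Lemma mdeg2_split (m : 'X_{1..n}) :
  mdeg m = 2%N -> exists i j, m = (U_(i) + U_(j))%MM.
Proof.
move=> m2.
have [i mi|m0] := pickP (fun i => m i != 0%N); last first.
  by move: m2; rewrite mdegE big1 // => i _; apply/eqP/negPn; rewrite m0.
have le_im : (U_(i) <= m)%MM.
  by apply/mnm_lepP => k; rewrite mnm1E; case: eqP => // <-; rewrite lt0n.
have : mdeg (m - U_(i))%MM == 1%N.
  by rewrite -(eqn_add2r 1) -[X in (_ + X)%N](mdeg1 i) -mdegD submK // m2.
by case/mdeg1P => j /eqP e; exists j, i; rewrite -e submK.
Qed.

(** If every exponent is even, the monomial is the square of a monomial of
    degree 2, that is, a product of two squared variables. *)
Lemma sign_sum_quartic_monomial (m : 'X_{1..n}) : mdeg m = 4%N ->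
  exists C, forall u,
    \prod_i (if odd (m i) then 0 else 2 * u i ^+ m i)
    = quad C (fun i => u i ^+ 2).
Proof.
move=> m4; have [/existsP[i oi]|] := boolP [exists i, odd (m i)].
  exists 0 => u; rewrite (bigD1 i) //= oi mul0r /quad big1 // => a _.
  by rewrite big1 // => b _; rewrite mxE !mul0r.
rewrite negb_exists => /forallP even_m.
pose k := [multinom (m i)./2 | i < n].
have mk i : m i = (k i).*2 by rewrite mnmE even_halfK.
have k2 : mdeg k = 2%N.
  apply: double_inj; rewrite -[RHS]m4 !mdegE -muln2 big_distrl /=.
  by apply: eq_bigr => i _; rewrite muln2 mk.
have [a [b kab]] := mdeg2_split k2.
exists (\matrix_(i, j) (2 ^+ n * ((i == a) && (j == b))%:R)) => u.
transitivity (2 ^+ n * (u a ^+ 2 * u b ^+ 2)).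
  transitivity (\prod_i (2 * (u i ^+ 2) ^+ (U_(a)%MM i + U_(b)%MM i))).
    apply: eq_bigr => i _; rewrite (negbTE (even_m i)) mk -mul2n exprM.
    by rewrite kab mnmDE.
  rewrite big_split /= prodr_const card_ord; congr (_ * _).
  under eq_bigr do rewrite exprD.
  rewrite big_split /=; congr (_ * _).
    rewrite (bigD1 a) //= mnm1E eqxx expr1 big1 ?mulr1 // => i ia.
    by rewrite mnm1E eq_sym (negbTE ia).
  rewrite (bigD1 b) //= mnm1E eqxx expr1 big1 ?mulr1 // => i ib.
  by rewrite mnm1E eq_sym (negbTE ib).
rewrite /quad (bigD1 a) //= [X in _ + X]big1 => [|i ia]; last first.
  by apply: big1 => j _; rewrite mxE (negbTE ia) /= mulr0 !mul0r.
rewrite (bigD1 b) //= [X in _ + X + _]big1 => [|j jb]; last first.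
  by rewrite mxE (negbTE jb) andbF mulr0 !mul0r.
by rewrite mxE !eqxx /=; ring.
Qed.

(** The map that sends [q] to its sign sum is linear, so the case of monomials
    suffices. *)
Lemma sign_sum_quartic q : q \is 4.-homog ->
  exists C, forall u, sign_sum q u = quad C (fun i => u i ^+ 2).
Proof.
move=> /dhomogP q4.
have [C C_E] : exists C, forall u,
    \sum_(m <- msupp q) q@_m *
      \prod_i (if odd (m i) then 0 else 2 * u i ^+ m i)
    = quad C (fun i => u i ^+ 2).
  elim: (msupp q) q4 => [|m s IHs] s4.
    exists 0 => u; rewrite big_nil /quad big1 // => i _.
    by rewrite big1 // => j _; rewrite mxE !mul0r.
  have [|C1 E1] := IHs; first by move=> k ks; apply: s4; rewrite inE ks orbT.
  have [C2 E2] := sign_sum_quartic_monomial (s4 m (mem_head _ _)).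
  exists (q@_m *: C2 + C1) => u; rewrite big_cons E1 E2 /quad mulr_sumr.
  rewrite -big_split; apply: eq_bigr => i _ /=.
  rewrite mulr_sumr -big_split; apply: eq_bigr => j _ /=.
  by rewrite !mxE; ring.
exists C => u; rewrite -C_E /sign_sum.
under eq_bigr do rewrite mevalE.
rewrite exchange_big /=; apply: eq_bigr => m _.
by rewrite -mulr_sumr sign_sum_monomial.
Qed.

(** At a coordinate vector a sign pattern acts as [+1] or [-1] on the whole
    vector, which a form of even degree does not see. *)
Lemma sign_sum_axis d q (k : 'I_n) : ~~ odd d -> q \is d.-homog ->
  sign_sum q (fun i => (i == k)%:R) = 2 ^+ n * q.@[fun i => (i == k)%:R].
Proof.
move=> even_d /dhomogP qd; rewrite /sign_sum.
rewrite (eq_bigr (fun=> q.@[fun i => (i == k)%:R])) => [|e _].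
  by rewrite sumr_const card_ffun card_bool card_ord -[LHS]mulr_natl natrX.
rewrite !mevalE; apply: eq_big_seq => m /qd md; congr (_ * _).
transitivity (\prod_i ((-1) ^+ e k) ^+ m i * \prod_i ((i == k)%:R : R) ^+ m i).
  rewrite -big_split /=; apply: eq_bigr => i _; rewrite -exprMn /flip.
  by case: eqP => [->|] //; rewrite !mulr0.
rewrite prodrXr -mdegE [mdeg m]md -exprM mulnC exprM -signr_odd.
by rewrite (negbTE even_d) expr1n mul1r.
Qed.

End SignSum.

(** * The obstruction given by zeros in the nonnegative orthant *)

Section Obstruction.
Variable R : realType.
Implicit Types (f : {mpoly R[4]}) (y u : 'I_4 -> R).

Lemma at_squaresE f u : (at_squares f).@[u] = f.@[fun i => u i ^+ 2].
Proof.
rewrite /at_squares comp_mpoly_meval; apply: meval_eq => i.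
by rewrite tnth_mktuple rmorphXn /= mevalXU.
Qed.

(** The matrices [C] stand for the sign sums of the summands: these vanish at
    the nonnegative zeros of [f], because squares that add up to zero are all
    zero.  If that forces [C k k = 0], each summand vanishes at the [k]-th
    coordinate vector. *)
Lemma Sigma48_at_squares_vanish f (k : 'I_4) :
  Sigma48 (at_squares f) ->
  (forall C : 'M[R]_4,
    (forall y, (forall i, 0 <= y i) -> f.@[y] = 0 -> quad C y = 0) ->
    C k k = 0) ->
  f.@[fun i => (i == k)%:R] = 0.
Proof.
move=> [_ [s s4 fE]] kill.
have pE u : f.@[fun i => u i ^+ 2] = \sum_(q <- s) q.@[u] ^+ 2.
  rewrite -at_squaresE fE raddf_sum /=.
  by apply: eq_bigr => q _; rewrite rmorphXn.
rewrite (@meval_eq _ _ _ (fun i => ((i == k)%:R : R) ^+ 2)); last first.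
  by move=> i; case: (i == k); rewrite ?expr1n ?expr0n.
rewrite pE big_seq big1 // => q qs.
have q4 : q \is 4.-homog by exact: (allP s4).
have [C CE] := sign_sum_quartic q4.
have Ck : C k k = 0.
  apply: kill => y y0 fy.
  have -> : quad C y = quad C (fun i => Num.sqrt (y i) ^+ 2).
    by apply: eq_bigr => i _; apply: eq_bigr => j _; rewrite !sqr_sqrtr.
  rewrite -CE; apply: big1 => e _.
  have : \sum_(q <- s) q.@[flip e (fun i => Num.sqrt (y i))] ^+ 2 == 0.
    rewrite -pE -fy; apply/eqP/meval_eq => i.
    by rewrite /flip exprMn sqrr_sign mul1r sqr_sqrtr.
  rewrite psumr_eq0 => [/allP/(_ _ qs)|? _]; last exact: sqr_ge0.
  by rewrite /= sqrf_eq0 => /eqP.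
have : sign_sum q (fun i => (i == k)%:R) = 0.
  rewrite CE /quad big1 // => i _; rewrite big1 // => j _.
  case: (eqVneq i k) => [->|_]; last by rewrite expr0n mulr0 mul0r.
  case: (eqVneq j k) => [->|_]; last by rewrite expr0n mulr0.
  by rewrite Ck !mul0r.
rewrite (sign_sum_axis _ _ q4) // => /eqP.
by rewrite mulf_eq0 expf_eq0 pnatr_eq0 /= => /eqP ->; rewrite expr0n.
Qed.

Definition pt (a b c d : R) : 'I_4 -> R := tnth [tuple a; b; c; d].

(** By Vieta, these are up to sign the coefficients of
    [(X - a) (X - b) (X - c) (X - d)]. *)
Lemma mesym_pt (a b c d : R) :
  [/\ (mesym 4 R 1).@[pt a b c d] = a + b + c + d,
      (mesym 4 R 2).@[pt a b c d] = a*b + a*c + a*d + b*c + b*d + c*d,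
      (mesym 4 R 3).@[pt a b c d] = a*b*c + a*b*d + a*c*d + b*c*d
    & (mesym 4 R 4).@[pt a b c d] = a*b*c*d].
Proof.
have E k (lek : (k < 5)%N) := mroots_coeff [tuple a; b; c; d] (Ordinal lek).
have X k (lek : (k < 5)%N) : (mesym 4 R k).@[pt a b c d] =
  (-1) ^+ k * (\prod_(x <- [:: a; b; c; d]) ('X - x%:P))`_(4 - k).
  by rewrite (E k lek) mulrA -exprMn mulrNN mulr1 expr1n mul1r.
rewrite !X // !big_cons big_nil !mulrBl !(coefB, coefXM, coefCM, coef1) /=.
by split; rewrite ?coefXM ?coefCM ?coefX ?coefC /= ; ring.
Qed.

Definition quad4 (q0 q1 q2 q3 r01 r02 r03 r12 r13 r23 a b c d : R) : R :=
  q0 * a ^+ 2 + q1 * b ^+ 2 + q2 * c ^+ 2 + q3 * d ^+ 2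
  + r01 * (a * b) + r02 * (a * c) + r03 * (a * d)
  + r12 * (b * c) + r13 * (b * d) + r23 * (c * d).

Lemma quad_pt (C : 'M[R]_4) : exists q1 q2 q3 r01 r02 r03 r12 r13 r23,
  forall a b c d, quad C (pt a b c d) =
    quad4 (C ord0 ord0) q1 q2 q3 r01 r02 r03 r12 r13 r23 a b c d.
Proof.
pose o1 : 'I_4 := lift ord0 ord0; pose o2 : 'I_4 := lift ord0 (lift ord0 ord0).
pose o3 : 'I_4 := lift ord0 (lift ord0 (lift ord0 ord0)).
exists (C o1 o1), (C o2 o2), (C o3 o3), (C ord0 o1 + C o1 ord0),
  (C ord0 o2 + C o2 ord0), (C ord0 o3 + C o3 ord0), (C o1 o2 + C o2 o1),
  (C o1 o3 + C o3 o1), (C o2 o3 + C o3 o2) => a b c d.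
rewrite /quad4 /quad !big_ord_recl !big_ord0 /= -/o1 -/o2 -/o3.
have -> : pt a b c d ord0 = a by [].
have -> : pt a b c d o1 = b by [].
have -> : pt a b c d o2 = c by [].
have -> : pt a b c d o3 = d by [].
by ring.
Qed.

(** The criterion in coordinates, at the first coordinate vector; the
    [q_i] and [r_ij] are the coefficients of an arbitrary quadratic form. *)
Lemma not_Sigma48 f :
  f.@[pt 1 0 0 0] != 0 ->
  (forall q0 q1 q2 q3 r01 r02 r03 r12 r13 r23 : R,
    (forall a b c d, 0 <= a -> 0 <= b -> 0 <= c -> 0 <= d ->
      f.@[pt a b c d] = 0 ->
      quad4 q0 q1 q2 q3 r01 r02 r03 r12 r13 r23 a b c d = 0) ->
    q0 = 0) ->
  ~ Sigma48 (at_squares f).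
Proof.
move=> /eqP f1 kill sos; apply: f1.
rewrite (@meval_eq _ _ _ (fun i => (i == ord0)%:R : R)) => [|i]; last first.
  by case: i => -[|[|[|[|]]]].
apply: Sigma48_at_squares_vanish sos _ => C vanish.
have [q1 [q2 [q3 [r01 [r02 [r03 [r12 [r13 [r23 CE]]]]]]]]] := quad_pt C.
apply: (kill _ q1 q2 q3 r01 r02 r03 r12 r13 r23) => a b c d a0 b0 c0 d0 f0.
rewrite -CE; apply: vanish f0; case=> -[|[|[|[|]]]] //.
Qed.

(** * The two families *)

Lemma f_ab_pt (t a b c d : R) :
  (f_ab t).@[pt a b c d] =
  let s1 := a + b + c + d in
  let s2 := a*b + a*c + a*d + b*c + b*d + c*d in
  let s3 := a*b*c + a*b*d + a*c*d + b*c*d in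
  let s4 := a*b*c*d in
  3^-1 * (3 * s1 ^+ 4 - (2 * (t + 7)) * (s1 ^+ 2 * s2)
    + (8 * (t + 1)) * s2 ^+ 2 + (t ^+ 2 - 6 * t + 21) * (s1 * s3)
    - (16 * (t ^+ 2 + 3)) * s4).
Proof.
have [e1 e2 e3 e4] := mesym_pt a b c d.
by rewrite /f_ab !(mevalZ, mevalB, mevalD, mevalM, rmorphXn) /= e1 e2 e3 e4.
Qed.

Lemma f_c_pt (t a b c d : R) :
  (f_c t).@[pt a b c d] =
  let s1 := a + b + c + d in
  let s2 := a*b + a*c + a*d + b*c + b*d + c*d in
  let s3 := a*b*c + a*b*d + a*c*d + b*c*d in
  let s4 := a*b*c*d in
  9^-1 * (9 * s1 ^+ 4 - (6 * (t + 7)) * (s1 ^+ 2 * s2)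
    + ((t + 7) ^+ 2) * s2 ^+ 2 + (12 * (t - 1)) * (s1 * s3)
    - (12 * (t - 1) * (3 * t + 13)) * s4).
Proof.
have [e1 e2 e3 e4] := mesym_pt a b c d.
by rewrite /f_c !(mevalZ, mevalB, mevalD, mevalM, rmorphXn) /= e1 e2 e3 e4.
Qed.

(** The zeros [(1,1,0,0)], ... give [r_ij = -(q_i + q_j)].  Then
    [Q(1,1,1,1) = -2 (q_0 + q_1 + q_2 + q_3)], and once this sum is zero,
    [Q(t,1,1,1) = (t-1)^2 q_0]. *)
Lemma f_ab_not_Sigma48 (t : R) :
  0 < t -> t != 1 -> ~ Sigma48 (at_squares (f_ab t)).
Proof.
move=> t0 t1; apply: not_Sigma48.
  by rewrite (_ : _.@[_] = 1) ?oner_neq0 // f_ab_pt /=; field.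
move=> q0 q1 q2 q3 r01 r02 r03 r12 r13 r23.
set Q := quad4 _ _ _ _ _ _ _ _ _ _ => Q0.
(* The elimination above as a single linear identity. *)
have : (t - 1) ^+ 2 * q0 = Q t 1 1 1
    - t * (Q 1 1 0 0 + Q 1 0 1 0 + Q 1 0 0 1)
    - (Q 0 1 1 0 + Q 0 1 0 1 + Q 0 0 1 1)
    - (t + 1) / 2 * (Q 1 1 1 1 - (Q 1 1 0 0 + Q 1 0 1 0 + Q 1 0 0 1)
                     - (Q 0 1 1 0 + Q 0 1 0 1 + Q 0 0 1 1)).
  by rewrite /Q /quad4; field.
rewrite !Q0 ?ler01 ?(ltW t0) ?f_ab_pt //=; try ring.
rewrite !(addr0, subr0, mulr0).
by move/eqP; rewrite mulf_eq0 expf_eq0 /= subr_eq0 (negbTE t1) => /eqP.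
Qed.

(** Where [sigma_3 = sigma_4 = 0], [9 f_c] is the square of
    [3 sigma_1^2 - (t + 7) sigma_2], which produces zeros of the form
    [(x,1,0,0)].  Comparing [Q] at [(x,1,0,0)] and [(1,x,0,0)] gives
    [q_0 = q_1] since [x^2 <> 1], and likewise for the other pairs, so all [q_i]
    agree.  The same points then determine each [r_ij] in terms of [q_0], and
    the zero [(1,1,1,1)] leaves only [q_0 = 0]. *)
Lemma f_c_not_Sigma48 (t : R) : 5 < t -> ~ Sigma48 (at_squares (f_c t)).
Proof.
move=> t5; apply: not_Sigma48.
  by rewrite (_ : _.@[_] = 1) ?oner_neq0 // f_c_pt /=; field.
move=> q0 q1 q2 q3 r01 r02 r03 r12 r13 r23.
set Q := quad4 _ _ _ _ _ _ _ _ _ _ => Q0.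
(* The larger root of [3 x^2 - (t + 1) x + 3]. *)
pose x := (t + 1 + Num.sqrt ((t + 1) ^+ 2 - 36)) / 6.
have xE : 3 * (1 + x ^+ 2) = (t + 1) * x.
  have := @sqr_sqrtr R ((t + 1) ^+ 2 - 36) ltac:(nra).
  rewrite /x; set w := Num.sqrt _ => ww; nra.
have x1 : 1 < x by rewrite /x; have := sqrtr_ge0 ((t + 1) ^+ 2 - 36); lra.
have x0 : 0 < x by lra.
have Q0_edge a b c d : 0 <= a -> 0 <= b -> 0 <= c -> 0 <= d ->
  a * b * c + a * b * d + a * c * d + b * c * d = 0 -> a * b * c * d = 0 ->
  3 * (a ^+ 2 + b ^+ 2 + c ^+ 2 + d ^+ 2)
    - (t + 1) * (a*b + a*c + a*d + b*c + b*d + c*d) = 0 ->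
  Q a b c d = 0.
  move=> a0 b0 c0 d0 s3 s4 E; apply: Q0 => //.
  rewrite f_c_pt /= s3 s4 !mulr0 addr0 subr0.
  transitivity (9^-1 * (3 * (a ^+ 2 + b ^+ 2 + c ^+ 2 + d ^+ 2)
    - (t + 1) * (a*b + a*c + a*d + b*c + b*d + c*d)) ^+ 2); first by ring.
  by rewrite E expr0n mulr0.
have xE' : 3 * (1 + x ^+ 2) - (t + 1) * x = 0 by rewrite xE subrr.
(* The sum of [Q] over the twelve permutations of [(x,1,0,0)], minus
   [2 x Q(1,1,1,1)], cancels the [r_ij] and equals
   [delta * (q0 + q1 + q2 + q3)]; the differences [Q x 1 0 0 - Q 1 x 0 0], ...
   equal [(x^2 - 1) (q0 - q1)], ... *)
pose delta := 3 * (x ^+ 2 + 1) - 2 * x.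
have : 4 * (x ^+ 2 - 1) * delta * q0 =
    (x ^+ 2 - 1) *
      (Q x 1 0 0 + Q 1 x 0 0 + Q x 0 1 0 + Q 1 0 x 0 + Q x 0 0 1 + Q 1 0 0 x
       + (Q 0 x 1 0 + Q 0 1 x 0 + Q 0 x 0 1 + Q 0 1 0 x + Q 0 0 x 1 + Q 0 0 1 x)
       - 2 * x * Q 1 1 1 1)
    + delta * ((Q x 1 0 0 - Q 1 x 0 0) + (Q x 0 1 0 - Q 1 0 x 0)
               + (Q x 0 0 1 - Q 1 0 0 x)).
  by rewrite /Q /quad4 /delta; ring.
rewrite (Q0 1 1 1 1) ?ler01 ?f_c_pt //=; last by field.
rewrite !Q0_edge ?ler01 ?(ltW x0) //; try ring;
  try by rewrite -[RHS]xE'; ring.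
rewrite !(addr0, subr0, mulr0) => /eqP.
have dx : 4 * (x ^+ 2 - 1) * delta != 0.
  by rewrite !mulf_neq0 //; apply/lt0r_neq0; rewrite /delta; nra.
by rewrite mulf_eq0 (negbTE dx) => /eqP.
Qed.

End Obstruction.

Theorem proposition1p5 (R : realType) (t : R) :
  (0 < t <= 5 -> t != 1 -> ~ Sigma48 (at_squares (f_ab t))) /\
  (5 < t -> ~ Sigma48 (at_squares (f_c t))).
Proof.
split; last exact: f_c_not_Sigma48.
by move=> /andP[t0 _]; apply: f_ab_not_Sigma48.
Qed.
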